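(* Let $D_1,\dots,D_k$ be tree degree sequences on a common set of $n$ vertices without common leaves. Then their (vertexwise) sum $\sum_{i=1}^k D_i$ is graphical, i.e. there is a simple graph on these $n$ vertices in which each vertex $v$ has degree $\sum_{i=1}^k d_v^{(i)}$.
   Context: A tree degree sequence on $n$ vertices is a list of positive integers $d_1,\dots,d_n$ with $\sum_i d_i=2n-2$. For sequences $D_1,\dots,D_k$ indexed by the same vertex set, $d_v^{(i)}$ denotes the entry of vertex $v$ in $D_i$. They have no common leaves if for every vertex $v$ and index $i$, $d_v^{(i)}=1$ implies $d_v^{(j)}>1$ for all $j\ne i$. A degree sequence is graphical if it is the degree sequence of some simple graph. *)

(* Defs.v *)
From mathcomp Require Import all_boot.

Set Implicit Arguments.
Unset Strict Implicit.
Unset Printing Implicit Defensive.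

(* The sum condition is the equation "sum = 2n - 2" with the subtraction moved
   to the other side, because subtraction on nat is truncated. *)
Definition tree_degree_sequence (n : nat) (d : 'I_n -> nat) : Prop :=
  (forall v, 0 < d v) /\ (\sum_(v < n) d v) + 2 = 2 * n.

Definition no_common_leaves (n k : nat) (D : 'I_k -> 'I_n -> nat) : Prop :=
  forall (v : 'I_n) (i : 'I_k), D i v = 1 ->
    forall j : 'I_k, j != i -> 1 < D j v.

Definition simple_graph (V : finType) (e : rel V) : Prop :=
  symmetric e /\ irreflexive e.

Definition degree (V : finType) (e : rel V) (v : V) : nat :=
  #|[set w | e v w]|.

Definition graphical (n : nat) (d : 'I_n -> nat) : Prop :=
  exists e : rel 'I_n, simple_graph e /\ forall v, degree e v = d v.

(* Main.v *)
Require Import Defs.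
From mathcomp Require Import all_boot.
From mathcomp Require Import zify.

(** Write m = 2k - 1.  Since no vertex is a leaf twice, every vertex of the sum
    has degree at least m, and the degrees add up to (m + 1)(n - 1); these two
    facts alone suffice.  If all degrees are m, then n = m + 1 and the complete
    graph works.  Otherwise some vertex v has degree exactly m and some w has
    degree more than m.  Delete v, lower w by one and realize the rest
    inductively.  Then attach v to w and, k - 1 times, replace an edge xy
    avoiding v and its neighbours by the path x v y: this raises the degree of
    v by 2 and keeps all others, and such an edge exists because x has more
    neighbours than v. *)

Section GraphSurgery.

Variable V : finType.
Implicit Types (e : rel V) (A : {set V}) (f : V -> nat).

Lemma attach_leaf e (v w : V) :
  simple_graph e -> degree e v = 0 -> v != w ->
  exists e', [/\ simple_graph e', degree e' v = 1,
    degree e' w = (degree e w).+1 &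
    forall z, z != v -> z != w -> degree e' z = degree e z].
Proof.
move=> [esym eirr] dv vw.
have ev z : e v z = false.
  by move/eqP: dv; rewrite cards_eq0 => /eqP/setP/(_ z); rewrite !inE.
have ev' z : e z v = false by rewrite esym ev.
exists [rel a b | e a b || ((a == v) && (b == w) || (a == w) && (b == v))].
split; first split.
- move=> a b /=; rewrite esym; congr (_ || _).
  by rewrite orbC ![(b == _) && _]andbC.
- move=> a /=; rewrite eirr /=; apply/negbTE.
  by apply: contra vw => /orP[] /andP[/eqP <- /eqP <-].
- rewrite /degree -(cards1 w); apply: eq_card => z.
  by rewrite !inE /= ev eqxx (negbTE vw) orbF.
- have -> : (degree e w).+1 = #|v |: [set z | e w z]|.
    by rewrite cardsU1 inE ev'.
  apply: eq_card => z.
  by rewrite !inE /= eqxx (eq_sym w) (negbTE vw) /= orbC.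
- move=> z zv zw; apply: eq_card => y.
  by rewrite !inE /= (negbTE zv) (negbTE zw) orbF.
Qed.

Lemma pinch_edge e (v x y : V) :
  simple_graph e -> e x y -> x != v -> y != v -> ~~ e v x -> ~~ e v y ->
  exists e', [/\ simple_graph e', degree e' v = degree e v + 2 &
    forall z, z != v -> degree e' z = degree e z].
Proof.
move=> [esym eirr] exy xv yv evx evy.
have eyx : e y x by rewrite esym.
have xy : x != y by apply: contraTneq exy => ->; rewrite eirr.
pose on_xy := [pred a | (a == x) || (a == y)].
(* Since [e] is irreflexive, an edge with both ends among [x] and [y] is the edge [xy] itself, so
   the last branch deletes only that edge. *)
exists [rel a b | if a == v then e a b || on_xy b else
                  if b == v then e a b || on_xy a else
                  e a b && ~~ (on_xy a && on_xy b)].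
split; first split.
- move=> a b /=; rewrite esym [on_xy a && _]andbC.
  by have [->|] := eqVneq a v; have [->|] := eqVneq b v.
- move=> a /=; rewrite eirr /=; case: eqVneq => // ->.
  by rewrite !(eq_sym v) (negbTE xv) (negbTE yv).
- have -> : degree e v + 2 = #|x |: (y |: [set z | e v z])|.
    rewrite !cardsU1 !inE (negbTE evx) (negbTE evy) (negbTE xy) /= /degree.
    lia.
  apply: eq_card => z.
  by rewrite !inE /= eqxx orbC orbA.
- have pinched a b : e a b -> a != v -> ~~ e v a ->
      #|v |: ([set z | e a z] :\ b)| = degree e a.
    move=> eab av eva; rewrite cardsU1 !inE [e a v]esym (negbTE eva) andbF.
    by rewrite /degree [RHS](cardsD1 b) inE eab.
  move=> z zv; have [zx|zx] := eqVneq z x; [|have [zy|zy] := eqVneq z y].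
  + subst z; rewrite -(pinched x y) //; apply: eq_card => b.
    rewrite !inE /= (negbTE xv) eqxx /=; case: (eqVneq b v) => //= _.
      by rewrite orbT.
    by have [->|_] := eqVneq b x; rewrite ?eirr ?andbF //= andbC.
  + subst z; rewrite -(pinched y x) //; apply: eq_card => b.
    rewrite !inE /= (negbTE yv) eqxx orbT /=; case: (eqVneq b v) => //= _.
      by rewrite orbT.
    have [->|_] := eqVneq b y; first by rewrite eirr ?andbF.
    by rewrite orbF andbC.
  + apply: eq_card => b.
    by rewrite !inE /= (negbTE zv) (negbTE zx) (negbTE zy) /= andbT orbF if_same.
Qed.

(** Together [v] and its neighbours number at most [m], so some [x] in [A] is none of them. As [x]
    has more neighbours than [v], one of them, [y], is not adjacent to [v]; it may lie outside
    [A]. *)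
Lemma raise_degree_by_two e A (v : V) (m : nat) :
  simple_graph e -> (forall x, x \in A -> x != v -> m <= degree e x) ->
  degree e v < m < #|A| ->
  exists e', [/\ simple_graph e', degree e' v = degree e v + 2 &
    forall z, z != v -> degree e' z = degree e z].
Proof.
move=> e_simple dA /andP[dv mA]; have [esym eirr] := e_simple.
have [x xA xN] : exists2 x, x \in A & x \notin v |: [set z | e v z].
  apply/subsetPn; apply: contraL mA => /subset_leq_card AN.
  rewrite -leqNgt (leq_trans AN) // cardsU1 inE eirr /=; exact: dv.
move: xN; rewrite !inE negb_or => /andP[xv evx].
have [y] : exists2 y, y \in [set z | e x z] & y \notin [set z | e v z].
  apply/subsetPn; apply: contraL dv => /subset_leq_card xN.
  by rewrite -leqNgt (leq_trans (dA x xA xv)).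
rewrite !inE => exy evy.
apply: (@pinch_edge e v x y) => //.
by apply: contraTneq exy => ->; rewrite esym.
Qed.

(** Each round leaves the other degrees alone, so their lower bound survives, and the bound on
    [degree e v + s.*2] keeps [v] below [m] before every round. *)
Lemma raise_degree e A (v : V) (m s : nat) :
  simple_graph e -> (forall x, x \in A -> x != v -> m <= degree e x) ->
  degree e v + s.*2 <= m -> m < #|A| ->
  exists e', [/\ simple_graph e', degree e' v = degree e v + s.*2 &
    forall z, z != v -> degree e' z = degree e z].
Proof.
elim: s e => [|s IHs] e e_simple dA dv mA.
  by exists e; split; rewrite ?addn0.
have [|e1 [e1_simple d1v d1]] := @raise_degree_by_two e A v m e_simple dA.
  by rewrite mA andbT; lia.
have [|||e2 [e2_simple d2v d2]] := IHs e1 e1_simple => //.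
- by move=> x xA xv; rewrite d1 // dA.
- by rewrite d1v; lia.
exists e2; split=> //; first by rewrite d2v d1v; lia.
by move=> z zv; rewrite d2 // d1.
Qed.

Lemma complete_realization A :
  exists e, simple_graph e /\
    forall v, degree e v = if v \in A then #|A|.-1 else 0.
Proof.
exists [rel a b | [&& a \in A, b \in A & a != b]]; split; first split.
- by move=> a b /=; rewrite andbCA eq_sym.
- by move=> a /=; rewrite eqxx !andbF.
move=> v; case: ifP => vA.
  rewrite (cardsD1 v A) vA /=; apply: eq_card => z.
  by rewrite !inE /= vA /= andbC eq_sym.
by apply/eqP; rewrite cards_eq0; apply/eqP/setP => z; rewrite !inE /= vA.
Qed.

(** Deleted vertices stay in [V] with prescribed degree 0, so the induction on [#|A|] keeps the
    vertex type fixed. The odd form of [m] reflects how a vertex of degree [m] is rebuilt: one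
    attached edge, then [t] raises by two. *)
Lemma realization_on A f (t : nat) (m := t.*2.+1) :
  (forall v, v \notin A -> f v = 0) ->
  (forall v, v \in A -> m <= f v) ->
  \sum_(v in A) f v + m.+1 = m.+1 * #|A| ->
  exists e, simple_graph e /\ forall v, degree e v = f v.
Proof.
have [c] := ubnP #|A|; elim: c A f => // c IHc A f Ac f0 f_ge f_sum.
have sum_m : \sum_(v in A) m = #|A| * m by rewrite sum_nat_const.
have [/existsP[w /andP[wA fw]] | no_w] :=
  boolP [exists w, (w \in A) && (m < f w)]; last first.
  have fE v : v \in A -> f v = m.
    move=> vA; apply/eqP; rewrite eqn_leq f_ge // andbT leqNgt.
    by apply: contra no_w => fv; apply/existsP; exists v; rewrite vA.
  have cA : #|A| = m.+1 by move: f_sum; rewrite (eq_bigr _ fE) sum_m; nia.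
  have [e [e_simple de]] := complete_realization A.
  exists e; split=> // v; rewrite de cA /=.
  by case: ifPn => vA; [rewrite fE | rewrite f0].
(* The excess at [w] makes the sum, which is [m.+1 * (#|A| - 1)], larger than [m * #|A|]. *)
have mA : m.+1 < #|A|.
  have : \sum_(v in A | v != w) m <= \sum_(v in A | v != w) f v.
    by apply: leq_sum => v /andP[vA _]; apply: f_ge.
  move: sum_m f_sum; rewrite (bigD1 w) //= [\sum_(v in A) f v](bigD1 w) //=.
  by nia.
(* If every value on [A] exceeded [m], the sum would be at least [m.+1 * #|A|], which is too
   large. *)
have [v vA fv] : exists2 v, v \in A & f v = m.
  have [/existsP[v /andP[vA /eqP fv]] | no_v] :=
    boolP [exists v, (v \in A) && (f v == m)].
    by exists v.
  have : \sum_(v in A) m.+1 <= \sum_(v in A) f v.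
    apply: leq_sum => v vA; rewrite ltn_neqAle f_ge // andbT.
    by apply: contra no_v => /eqP mv; apply/existsP; exists v; rewrite vA mv /=.
  by rewrite sum_nat_const; lia.
have wv : w != v by apply: contraTneq fw => ->; rewrite fv ltnn.
(* The total drops by [m] at [v] and by 1 at [w], just as the sum condition demands for one vertex
   fewer; [g w] is still at least [m]. *)
pose g z := if z == v then 0 else if z == w then (f w).-1 else f z.
have cAv : #|A| = (#|A :\ v|).+1 by rewrite (cardsD1 v) vA.
have [||||e0 [e0_simple d0]] := IHc (A :\ v) g.
- by lia.
- move=> z; rewrite !inE /g; case: eqVneq => //= zv.
  by case: eqVneq => [->|_ /f0 //]; rewrite wA.
- move=> z; rewrite !inE /g => /andP[/negbTE -> zA].
  by case: eqVneq => // _; [lia | apply: f_ge].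
- move: f_sum; rewrite (big_setD1 v) //= !(big_setD1 (A := A :\ v) w) ?inE ?wv //=.
  rewrite (eq_bigr f (F1 := g)) => [|z]; last first.
    by rewrite !inE /g => /and3P[/negbTE -> /negbTE ->].
  by rewrite {1}/g (negbTE wv) eqxx fv cAv mulnS; set S := \sum_(i in _) _; lia.
have [||e1 [e1_simple d1v d1w d1]] := @attach_leaf e0 v w e0_simple.
- by rewrite d0 /g eqxx.
- by rewrite eq_sym.
have d1E z : z != v -> degree e1 z = f z.
  move=> zv; have [->|zw] := eqVneq z w.
    by rewrite d1w d0 /g (negbTE wv) eqxx; lia.
  by rewrite d1 // d0 /g (negbTE zv) (negbTE zw).
have [|||e2 [e2_simple d2v d2]] := @raise_degree e1 A v m t e1_simple.
- by move=> x xA xv; rewrite d1E // f_ge.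
- by rewrite d1v; lia.
- by lia.
exists e2; split=> // z; have [->|zv] := eqVneq z v.
  by rewrite d2v d1v fv.
by rewrite d2 // d1E.
Qed.

End GraphSurgery.

(** At most one term is 1 and the others are at least 2. For [k = 0] the truncated predecessor gives
    the bound 0. *)
Lemma no_common_leaves_sum_ge (n k : nat) (D : 'I_k -> 'I_n -> nat) (v : 'I_n) :
  (forall i, 0 < D i v) -> no_common_leaves D ->
  k.*2.-1 <= \sum_(i < k) D i v.
Proof.
move=> D_gt0 D_leaves.
have sum2 : \sum_(i < k) 2 = k.*2 by rewrite sum_nat_const card_ord muln2.
have [/existsP[i /eqP Di] | no_leaf] := boolP [exists i, D i v == 1].
  have : \sum_(j < k | j != i) 2 <= \sum_(j < k | j != i) D j v.
    by apply: leq_sum => j ji; apply: D_leaves Di j ji.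
  move: sum2; rewrite (bigD1 i) //= [\sum_(j < k) D j v](bigD1 i) //= Di.
  by set S2 := \sum_(j < k | _) 2; set SD := \sum_(j < k | _) _; lia.
rewrite (leq_trans (leq_pred _)) // -sum2; apply: leq_sum => i _.
rewrite ltn_neqAle D_gt0 andbT eq_sym.
by apply: contra no_leaf => Di; apply/existsP; exists i.
Qed.

Theorem theorem1 (n k : nat) (D : 'I_k -> 'I_n -> nat)
    (D_tree : forall i : 'I_k, tree_degree_sequence (D i))
    (D_leaves : no_common_leaves D) :
  graphical (fun v : 'I_n => \sum_(i < k) D i v).
Proof.
have D_ge v : k.*2.-1 <= \sum_(i < k) D i v.
  by apply: no_common_leaves_sum_ge => // i; have [] := D_tree i.
have D_sum : \sum_(v < n) \sum_(i < k) D i v + k.*2 = k.*2 * n.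
  (* The summand [k.*2] is spread as 2 per tree, so that each tree contributes exactly [2 * n]. *)
  rewrite exchange_big /= -muln2 -[in k * 2](card_ord k) -sum_nat_const -big_split /=.
  rewrite (eq_bigr (fun=> 2 * n)) => [|i _]; last by have [] := D_tree i.
  by rewrite !sum_nat_const card_ord mulnA.
(* With no trees all degrees are 0 and the edgeless graph serves. For [k = t.+1], [k.*2.-1] computes
   to [t.*2.+1]. *)
case: k D D_tree D_leaves D_ge D_sum => [|t] D _ _ D_ge D_sum.
  have [e [e_simple de]] := complete_realization _ (set0 : {set 'I_n}).
  by exists e; split=> // v; rewrite de inE big_ord0.
apply: (@realization_on _ [set: 'I_n] _ t) => [v|v _|].
- by rewrite inE.
- exact: D_ge.
- rewrite cardsT card_ord -[RHS]D_sum; congr (_ + _).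
  by apply: eq_bigl => v; rewrite inE.
Qed.
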